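(* Let $X$ be a real-valued random variable with cdf $F$ and density $f=F'$, let $a<b$ be real numbers, and let $\mathcal{G}$ be a sub-sigma-field of the underlying probability space, with conditional cdf $F(x\mid\mathcal{G})=\mathbb{P}[X\le x\mid\mathcal{G}]$. Assume that: (i) for all realizations of $\mathcal{G}$, $F(x\mid\mathcal{G})$ is a continuous function of $x$ over the interval $[a,b]$, and is differentiable in $x$ except perhaps at a countable set of points $D(\mathcal{G})\subset[a,b]$; (ii) for every $x\in[a,b]$, $F(\cdot\mid\mathcal{G})$ is differentiable at $x$ with probability 1; (iii) there is a random variable $\Gamma$ defined on the same probability space as $F(x\mid\mathcal{G})$ and a constant $K_\gamma<\infty$ such that $\mathbb{E}[\Gamma^2]\le K_\gamma$ and $\sup_{x\in[a,b]\setminus D(\mathcal{G})}F'(x\mid\mathcal{G})\le\Gamma$. Then, writing $f(x\mid\mathcal{G})=F'(x\mid\mathcal{G})$, for all $x\in[a,b]$ we have $$\mathbb{E}[f(x\mid\mathcal{G})]=f(x)\qquad\text{and}\qquad \mathrm{Var}[f(x\mid\mathcal{G})]\le K_\gamma .$$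
   Context: The density of $X$ is understood as the derivative of its cdf: $f(x)=F'(x)$. $F(\cdot\mid\mathcal{G})$ denotes a (regular) version of the conditional cdf of $X$ given $\mathcal{G}$, so it is a random nondecreasing function. $F'(x\mid\mathcal{G})=\frac{\mathrm{d}}{\mathrm{d}x}F(x\mid\mathcal{G})$ is the derivative with respect to $x$ (as a function on $[a,b]$, so one-sided at the endpoints), and $f(x\mid\mathcal{G})=F'(x\mid\mathcal{G})$ wherever it exists; by (ii) it exists almost surely for each fixed $x\in[a,b]$. Expectation and variance are over the randomness of $\mathcal{G}$, with $x$ fixed. *)

(* Defs.v *)
From HB Require Import structures.
From mathcomp Require Import all_boot all_order all_algebra.
From mathcomp Require Import all_classical all_reals all_analysis.

Set Implicit Arguments.
Unset Strict Implicit.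
Unset Printing Implicit Defensive.
Import Order.TTheory GRing.Theory Num.Theory.
Import numFieldNormedType.Exports.

Local Open Scope classical_set_scope.
Local Open Scope ring_scope.

(* Derivatives of [g] at [x] as a function on [A]: the increment stays in [A],
   so for [A = `[a, b]] they are one-sided at the endpoints. *)
Definition diff_quotient {R : realType} (g : R -> R) (x y : R) : R :=
  (g y - g x) / (y - x).

Definition is_derive_within {R : realType} (A : set R) (g : R -> R) (x l : R) :=
  diff_quotient g x @ within A x^' --> l.

Definition derivable_within {R : realType} (A : set R) (g : R -> R) (x : R) :=
  cvg (diff_quotient g x @ within A x^').

(* Equal to the default value [point] of [lim] where [g] is not derivable. *)
Definition derive_within {R : realType} (A : set R) (g : R -> R) (x : R) : R :=
  lim (diff_quotient g x @ within A x^').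

Lemma is_derive_is_derive_within {R : realType} (A : set R) (g : R -> R)
    (x l : R) : is_derive x 1 g l -> is_derive_within A g x l.
Proof.
move=> [dg <-]; apply: cvg_within_filter.
have /cvgrPdist_lt dgl := (dg : _ @ _ --> 'D_1 g x).
apply/cvgrPdist_lt => e e0.
have [r /= r0 rP] := dgl e e0.
exists r => //= y xy yx.
have := rP (y - x); rewrite /= sub0r normrN distrC => /(_ xy).
rewrite subr_eq0 => /(_ yx).
by rewrite /diff_quotient /= [_ *: 1]mulr1 subrK mulrC.
Qed.

(* [Z] is a version of the conditional probability of [E] given [G]. *)
Definition is_cond_prob d (T : measurableType d) (R : realType)
    (P : probability T R) (G : set (set T)) (E : set T) (Z : T -> R) :=
  [/\ forall B : set R, measurable B -> G (Z @^-1` B),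
      P.-integrable [set: T] (EFin \o Z) &
      forall A, G A -> (\int[P]_(w in A) (Z w)%:E)%E = P (A `&` E)].

(* [Fc w x] is F(x | G) at the realization [w]; regularity is carried by the
   type: [Fc w] is nondecreasing and right-continuous, with limits 0 at -oo
   and 1 at +oo, for every [w]. *)
Definition is_regular_cond_cdf d (T : measurableType d) (R : realType)
    (P : probability T R) (X : {RV P >-> R}) (G : set (set T))
    (Fc : T -> cumulativeBounded (0 : R) (1 : R)) :=
  forall x : R, is_cond_prob P G [set w | X w <= x] (fun w => Fc w x).

(* Main.v *)
Require Import Defs.
From HB Require Import structures.
From mathcomp Require Import all_boot all_order all_algebra.
From mathcomp Require Import all_classical all_reals all_analysis.
From mathcomp Require Import measurable_realfun lra.
Import Order.TTheory GRing.Theory Num.Theory.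
Import numFieldNormedType.Exports.
Local Open Scope classical_set_scope.
Local Open Scope ring_scope.

(** Along a sequence [u n] in [[a, b]] tending to [x], the difference quotients
    of [F(. | G)] at [x] converge to [f(x | G)] almost surely, and their
    expectations are the difference quotients of [F], because the conditional
    cdf averages to the cdf; these tend to [f x].  The expectation formula is
    therefore an exchange of limit and expectation, and dominated convergence
    gives it once the quotients are bounded by the integrable [Gamma].

    That bound is a mean value inequality: a function continuous on [[a, b]]
    whose derivative is at most [M] off a countable set has increments at most
    [M] times the length ([increment_le]).  It applies to almost every
    realization with [M = Gamma w], and it controls the quotients at every [x],
    including the exceptional points of [D w].  As the conditional cdf is
    nondecreasing, the quotients lie between [0] and [Gamma], and so does their
    limit; its variance is then at most its second moment, which is at most
    [E[Gamma^2]] ([moments_of_dominated_limit]).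

    On the null event where [F(. | G)] is not derivable at [x], [f(x | G)] has a
    default value, and its measurability as a random variable is not given.
    Integrals are therefore compared with those of a measurable modification on
    a null set, by an equality of integrals valid for arbitrary functions
    ([integral_eq_off_null]). *)

(** * Integrals and null sets *)

Section ae_equal.
Local Open Scope ereal_scope.
Import HBNNSimple.
Context (d : measure_display) (T : measurableType d) (R : realType)
  (mu : {measure set T -> \bar R}).

(** The integral of a nonnegative function is a supremum over the simple
    functions below it, and cutting a simple function to zero on a null set
    does not change its integral. *)
Let ge0_integral_le_off_null (N : set T) (f g : T -> \bar R) :
  measurable N -> mu N = 0 -> (forall x, 0 <= f x) -> (forall x, 0 <= g x) ->
  (forall x, ~ N x -> f x = g x) -> \int[mu]_x f x <= \int[mu]_x g x.
Proof.
move=> mN N0 f0 g0 fg; rewrite !ge0_integralTE//.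
apply: ge_ereal_sup => _ [h /= hf <-].
pose h' := proj_nnsfun h (measurableC mN).
have h'E x : h' x = (h x * \1_(~` N) x)%R by rewrite /h' /=.
have -> : sintegral mu h = sintegral mu h'.
  rewrite -!integralT_nnsfun; apply: ae_eq_integral => //.
  - by apply/measurable_EFinP; exact: measurable_funPT.
  - by apply/measurable_EFinP; exact: measurable_funPT.
  exists N; split => // x /= /not_implyP[_] hh'; apply: contrapT => Nx.
  apply: hh'; congr EFin; apply: esym; have := h'E x.
  by rewrite indicE mem_set// mulr1; exact.
apply: ereal_sup_ubound; exists h' => // x; have := h'E x; rewrite indicE => ->.
have [/set_mem Nx|_] := boolP (x \in ~` N); last by rewrite mulr0.
by rewrite mulr1 -fg.
Qed.

(** Unlike [ae_eq_integral], this makes no measurability assumption on [f] and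
    [g]: it serves for a limit of random variables that takes a default value
    where the limit does not exist. *)
Lemma integral_eq_off_null (N : set T) (f g : T -> \bar R) :
  measurable N -> mu N = 0 ->
  (forall x, ~ N x -> f x = g x) -> \int[mu]_x f x = \int[mu]_x g x.
Proof.
move=> mN N0 fg; rewrite integralE [RHS]integralE.
by congr (_ - _); apply/eqP; rewrite eq_le;
  apply/andP; split; apply: (ge0_integral_le_off_null N _ _ mN N0) => // x Nx;
  rewrite unlock fg.
Qed.
End ae_equal.

(** * A mean value inequality with countably many exceptions *)

Lemma itvoo_not_countable {R : realType} {a b : R} :
  a < b -> ~ countable `]a, b[%classic.
Proof.
move=> ab /countable_lebesgue_measure0.
rewrite lebesgue_measure_itv /= lte_fin ab -EFinB => -[] /eqP.
by rewrite subr_eq0 gt_eqF.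
Qed.

(** If the conclusion fails, it fails for some [M' > M], and then
    [phi t = g t - M' t] satisfies [phi c < phi e].  The image of the countable
    set [D] cannot fill the interval between these values, so some level [y]
    there is not reached on [D].  At the last point [s] of [[c, e]] where
    [phi] is at most [y], [phi s = y], so [g] is derivable at [s] with derivative at
    most [M < M'], and [phi] falls below [y] just after [s]: a contradiction. *)
Lemma increment_le {R : realType} (g : R -> R) (a b M : R) (D : set R) :
  {within `[a, b], continuous g} -> countable D ->
  (forall x, (`[a, b] `\` D) x ->
    exists2 l, is_derive_within `[a, b] g x l & l <= M) ->
  forall c e, a <= c -> c < e -> e <= b -> g e - g c <= M * (e - c).
Proof.
move=> cg cD dg c e ac ce eb; rewrite leNgt; apply/negP => gce.
have [M' MM' gce'] : exists2 M', M < M' & M' * (e - c) < g e - g c.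
  have ec0 : 0 < e - c by rewrite subr_gt0.
  exists ((M + (g e - g c) / (e - c)) / 2).
    by rewrite midf_lt// ltr_pdivlMr.
  by rewrite -ltr_pdivlMr// midf_lt// ltr_pdivlMr.
pose phi t := g t - M' * t.
have phi_ce : phi c < phi e by rewrite /phi; lra.
have cphi : {within `[a, b], continuous phi}.
  by apply: within_continuousB => //; apply: continuous_subspaceT;
    exact: mulrl_continuous.
have [y yI yD] : exists2 y, `]phi c, phi e[%classic y & ~ (phi @` D) y.
  apply: contrapT => H; have := itvoo_not_countable phi_ce; apply.
  apply: (sub_countable _ (card_le_trans (card_image_le phi D) cD)).
  apply: subset_card_le => y yI; apply: contrapT => yD.
  by apply: H; exists y.
move: yI => /=; rewrite in_itv /= => /andP[cy ye].
pose S := [set t | c <= t <= e /\ phi t <= y].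
have Sc : S c by split; [rewrite lexx ltW|exact: ltW].
have supS : has_sup S.
  by split; [exists c|exists e => t [/andP[]]].
set s := sup S.
have S_le t : S t -> t <= s by exact: (sup_upper_bound supS).
have cs : c <= s by exact: S_le.
have se : s <= e by apply: ge_sup; [exists c|move=> t [/andP[]]].
have abs : `[a, b]%classic s.
  by rewrite /= in_itv /= (le_trans ac)// (le_trans se).
have phis : phi s <= y.
  rewrite leNgt; apply/negP => ys.
  move/subspace_continuousP : (cphi) => /(_ s abs) /cvgr_gt /(_ _ ys).
  move=> [r /= r0 rP].
  have [t St] := sup_adherent r0 supS; rewrite -/s => srt.
  have ts : t <= s by exact: S_le.
  case: St => /andP[ct te]; rewrite leNgt => /negP; apply; apply: rP.
    by rewrite /= ger0_norm ?subr_ge0// ltrBlDr -ltrBlDl.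
  by rewrite /= in_itv/= (le_trans ac ct) (le_trans te eb).
have lt_s_e : s < e.
  rewrite lt_neqAle se andbT; apply/eqP => seE.
  by move: phis; rewrite seE leNgt ye.
have phisE : phi s = y.
  have [] := @IVT R phi s e y se.
  - apply: continuous_subspaceW cphi => t /=; rewrite !in_itv/= => /andP[st te].
    by rewrite (le_trans (le_trans ac cs) st) (le_trans te eb).
  - by rewrite ge_min phis/= le_max (ltW ye) orbT.
  move=> t; rewrite in_itv/= => /andP[st te] phity.
  have : t <= s.
    by apply: S_le; split; rewrite ?phity ?te ?(le_trans cs st).
  by move=> ts; rewrite -phity; congr phi; apply/eqP; rewrite eq_le st ts.
have sD : ~ D s by move=> Ds; apply: yD; exists s.
have [l /cvgr_lt dl lM] := dg s (conj abs sD).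
have [r /= r0 rP] := dl _ (le_lt_trans lM MM').
(* close enough to [s] for the bound on the quotient, and still at most [e] *)
pose t := s + Num.min (r / 2) (e - s).
have st : s < t by rewrite ltrDl lt_min divr_gt0//= subr_gt0.
have te : t <= e by rewrite -lerBrDl ge_min lexx orbT.
have tr : t - s < r.
  by rewrite /t addrC addKr gt_min; apply/orP; left; rewrite ltr_pdivrMr//; lra.
have : diff_quotient g s t < M'.
  apply: rP; rewrite /= ?gt_eqF//.
    by rewrite ltr0_norm ?subr_lt0// opprB.
  rewrite /= in_itv /= (le_trans te eb) andbT.
  by rewrite (le_trans (le_trans ac cs))// ltW.
rewrite /diff_quotient ltr_pdivrMr ?subr_gt0// => H.
have : t <= s.
  apply: S_le; split; first by rewrite te (le_trans cs)// ltW.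
  by rewrite -phisE /phi; lra.
by rewrite leNgt st.
Qed.

(** * Moments of a dominated limit *)

Section dominated_limit.
Local Open Scope ereal_scope.
Context (d : measure_display) (T : measurableType d) (R : realType)
  (P : probability T R).

Lemma integrable_of_sqr (Y : {RV P >-> R}) (K : R) :
  'E_P[fun w => (Y w ^+ 2)%R] <= K%:E -> P.-integrable setT (EFin \o Y).
Proof.
move=> YK; have mY : measurable_fun setT Y by exact: measurable_funPT.
have iY2 : P.-integrable setT (EFin \o (fun w => 1 + Y w ^+ 2)%R).
  apply/integrableP; split.
    apply/measurable_EFinP; apply: measurable_funD => //.
    exact: measurable_funX.
  under eq_integral => w _.
    rewrite /= ger0_norm; last by rewrite addr_ge0// sqr_ge0.
    rewrite EFinD; over.
  rewrite ge0_integralD//; last 2 first.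
    by move=> w _; rewrite lee_fin sqr_ge0.
    by apply/measurable_EFinP; exact: measurable_funX.
  rewrite lte_add_pinfty//.
    by rewrite integral_cst// mul1e (le_lt_trans (probability_le1 _ _))// ltry.
  by move: YK; rewrite unlock => /le_lt_trans; apply; rewrite ltry.
apply: (le_integrable measurableT _ _ iY2); first exact/measurable_EFinP.
move=> w _; rewrite /= lee_fin [leRHS]ger0_norm; last first.
  by rewrite addr_ge0// sqr_ge0.
(* [t <= 1 + t ^ 2] is [(t - 1/2) ^ 2 + 3/4 >= 0] *)
rewrite -(real_normK (num_real (Y w))).
by have := sqr_ge0 (`|Y w| - 1/2)%R; nra.
Qed.

(** The limit [h] is constrained only off the null set [N] and need not be
    measurable; all computations are made on [h'], which is [h] cut to zero on
    [N].  As [0 <= h' <= Y] off [N], [V[h'] <= E[h' ^ 2] <= E[Y ^ 2]]. *)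
Lemma moments_of_dominated_limit (N : set T) (q : nat -> T -> R) (h : T -> R)
    (Y : {RV P >-> R}) (K m : R) :
  measurable N -> P N = 0 ->
  (forall n, measurable_fun setT (q n)) ->
  (forall w, ~ N w -> q n w @[n --> \oo] --> h w) ->
  (forall n w, ~ N w -> (0 <= q n w <= Y w)%R) ->
  'E_P[fun w => (Y w ^+ 2)%R] <= K%:E ->
  'E_P[q n] @[n --> \oo] --> m%:E ->
  'E_P[h] = m%:E /\ 'V_P[h] <= K%:E.
Proof.
move=> mN N0 mq qh qY YK qm.
pose h' w := (h w * \1_(~` N) w)%R.
have Noff w : ~ N w -> h' w = h w.
  by move=> Nw; rewrite /h' indicE mem_set// mulr1.
have Non w : N w -> h' w = 0%R.
  by move=> Nw; rewrite /h' indicE memNset ?mulr0//=; exact.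
have aeN (Q : T -> Prop) : (forall w, ~ N w -> Q w) -> {ae P, forall w, Q w}.
  by move=> NQ; exists N; split => // w /= nQ; apply: contrapT => /NQ.
have mI : measurable_fun setT (\1_(~` N) : T -> R).
  by apply: measurable_indic; exact: measurableC.
have mh' : measurable_fun setT h'.
  apply: (@measurable_fun_cvg _ _ _ _ (fun n w => q n w * \1_(~` N) w)%R).
    by move=> n; exact: measurable_funM.
  move=> w _; have [Nw|Nw] := pselect (N w).
    rewrite Non//; apply: cvg_near_cst; apply: nearW => n.
    by rewrite indicE memNset ?mulr0//=; exact.
  have -> : h' w = h w by exact: Noff.
  rewrite [X in X @ _](_ : _ = q ^~ w); first exact: qh.
  by apply/funext => n; rewrite indicE mem_set// mulr1.
have iY := integrable_of_sqr Y K YK.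
have h'Y w : ~ N w -> (0 <= h' w <= Y w)%R.
  move=> Nw; rewrite Noff//; have /cvg_lim <- // := qh _ Nw.
  have cq : cvgn (q ^~ w) by apply/cvg_ex; exists (h w); exact: qh.
  by rewrite limr_ge ?limr_le//; apply: nearW => n; have /andP[] := qY n w Nw.
have h'_sqr w : (h' w ^+ 2 <= Y w ^+ 2)%R.
  have [Nw|/h'Y /andP[h'0 h'Y']] := pselect (N w).
    by rewrite Non// expr0n sqr_ge0.
  by rewrite lerXn2r ?nnegrE ?(le_trans h'0).
have [ih' qh'] : P.-integrable setT (EFin \o h') /\
    'E_P[q n] @[n --> \oo] --> 'E_P[h'].
  have [||||ih' _ qh'] := @dominated_convergence _ _ _ P setT measurableT
    (fun n => EFin \o q n) (EFin \o h') (EFin \o Y) _ _ _ iY _.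
  - by move=> n; exact/measurable_EFinP.
  - exact/measurable_EFinP.
  - apply: aeN => w Nw _; apply: cvg_EFin; first exact: nearW.
    by rewrite /= Noff//; exact: qh.
  - apply: aeN => w Nw n _; have /andP[q0 qY'] := qY n w Nw.
    by rewrite /= lee_fin ger0_norm.
  have EE (Z : T -> R) : 'E_P[Z] = \int[P]_w (Z w)%:E by rewrite unlock.
  by split => //; under eq_fun do rewrite EE; rewrite EE.
have Eh (F : R -> R) : 'E_P[F \o h] = 'E_P[F \o h'].
  rewrite unlock; apply: (integral_eq_off_null _ _ _ _ N) => // w Nw.
  by rewrite /= Noff.
have Eh' : 'E_P[h'] = m%:E by exact: (cvg_unique _ qh' qm).
have Ehm : 'E_P[h] = m%:E by rewrite -Eh'; exact: (Eh id).
split => //.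
have -> : 'V_P[h] = 'V_P[h'].
  rewrite /variance unlock Ehm Eh'.
  exact: (Eh (fun r => (r - m) * (r - m))%R).
have mh'2 : measurable_fun setT (EFin \o (h' * h')%R).
  by apply/measurable_EFinP; exact: measurable_funM.
have h'2K : \int[P]_w (h' w ^+ 2)%:E <= K%:E.
  apply: le_trans YK; rewrite unlock; apply: ge0_le_integral => //.
  - by move=> w _; rewrite lee_fin sqr_ge0.
  - by apply/measurable_EFinP; apply: measurable_funX; exact: measurable_funPT.
  - by move=> w _; rewrite lee_fin.
have ih'2 : P.-integrable setT (EFin \o (h' * h')%R).
  apply/integrableP; split => //; rewrite (le_lt_trans _ (ltry K))//.
  apply: le_trans h'2K; rewrite le_eqVlt; apply/orP; left; apply/eqP.
  by apply: eq_integral => w _; rewrite /= ger0_norm// -?expr2 ?sqr_ge0.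
rewrite /variance covarianceE; [|exact/Lfun1_integrable..].
rewrite Eh' -EFinM leeBlDr//; apply: (@le_trans _ _ K%:E); last first.
  by rewrite leeDl// lee_fin -expr2 sqr_ge0.
by rewrite unlock.
Qed.
End dominated_limit.

(** * Sequences approaching a point inside a segment *)

(** The sequence runs along the segment from [x] to an endpoint distinct from
    [x], so that it serves equally at the endpoints of [[a, b]]. *)
Definition approach {R : realType} (a b x : R) (n : nat) : R :=
  x + ((if x < b then b else a) - x) / n.+1%:R.

Section approach.
Context {R : realType} {a b x : R} (ab : a < b) (abx : a <= x <= b).

Let e_neq : (if x < b then b else a) - x != 0.
Proof.
have /andP[ax xb] := abx.
rewrite subr_eq0; case: ltP => [/gt_eqF->//|bx].
by rewrite lt_eqF// (lt_le_trans ab).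
Qed.

Lemma approach_neq n : approach a b x n != x.
Proof.
rewrite -subr_eq0 /approach addrC addKr mulf_neq0 ?e_neq//.
Qed.

Lemma approach_itv n : a <= approach a b x n <= b.
Proof.
have /andP[ax xb] := abx; rewrite /approach.
set e := if _ then _ else _.
have /andP[ae eb] : a <= e <= b by rewrite /e; case: ifP; rewrite lexx (ltW ab).
(* the point is a convex combination of [x] and [e], both in [[a, b]] *)
have t0 : 0 <= n.+1%:R^-1 :> R by rewrite invr_ge0.
have t1 : n.+1%:R^-1 <= 1 :> R by rewrite invf_le1// ler1n.
move: (n.+1%:R^-1) t0 t1 => t t0 t1; have t1' : 0 <= 1 - t by rewrite subr_ge0.
have := mulr_ge0 t1'; have := mulr_ge0 t0 => mt mt'.
have xa0 : 0 <= x - a by rewrite subr_ge0.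
have bx0 : 0 <= b - x by rewrite subr_ge0.
have ea0 : 0 <= e - a by rewrite subr_ge0.
have be0 : 0 <= b - e by rewrite subr_ge0.
have := mt _ ea0; have := mt _ be0; have := mt' _ xa0; have := mt' _ bx0.
by move=> ? ? ? ?; apply/andP; split; lra.
Qed.

Lemma cvg_approach :
  approach a b x n @[n --> \oo] --> within `[a, b]%classic x^'.
Proof.
move=> A /= [r /= r0 rA].
have : approach a b x n @[n --> \oo] --> x.
  rewrite -[X in _ --> X]addr0; apply: cvgD; first exact: cvg_cst.
  rewrite -[X in _ --> X](mulr0 ((if x < b then b else a) - x)).
  apply: cvgM; first exact: cvg_cst.
  exact: cvg_harmonic.
move=> /cvgrPdist_lt /(_ r r0); apply: filterS => n xn.
apply: rA => //=; first exact: approach_neq.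
by rewrite in_itv /= approach_itv.
Qed.
End approach.

(** * Difference quotients of a conditional cdf *)

Lemma diff_quotient_bound {R : realType} (g : R -> R) (a b M x y : R) :
  {homo g : s t / s <= t} ->
  (forall s t, a <= s -> s < t -> t <= b -> g t - g s <= M * (t - s)) ->
  a <= x <= b -> a <= y <= b -> y != x -> 0 <= diff_quotient g x y <= M.
Proof.
move=> g_nd gM /andP[ax xb] /andP[ay yb].
rewrite /diff_quotient neq_lt => /orP[yx|xy].
  have yx0 : 0 < x - y by rewrite subr_gt0.
  have gyx : 0 <= g x - g y by rewrite subr_ge0 g_nd// ltW.
  rewrite -mulrNN -invrN !opprB divr_ge0 ?(ltW yx0)//= ler_pdivrMr//.
  exact: gM.
have xy0 : 0 < y - x by rewrite subr_gt0.
have gxy : 0 <= g y - g x by rewrite subr_ge0 g_nd// ltW.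
by rewrite divr_ge0 ?(ltW xy0)//= ler_pdivrMr// gM.
Qed.

Section cond_cdf.
Context (d : measure_display) (T : measurableType d) (R : realType)
  (P : probability T R) (X : {RV P >-> R}) (G : set (set T))
  (Fc : T -> cumulativeBounded (0 : R) (1 : R)).
Hypotheses (sG : sigma_algebra [set: T] G) (subG : G `<=` measurable)
  (FcE : is_regular_cond_cdf X G Fc).

Lemma measurable_cond_cdf y : measurable_fun [set: T] (fun w => Fc w y).
Proof.
by have [mF _ _] := FcE y; move=> _ B mB; rewrite setTI; apply/subG/mF.
Qed.

(** The defining property of conditional probability on the sure event. *)
Lemma expectation_cond_cdf y : ('E_P[fun w => Fc w y] = cdf X y)%E.
Proof.
have [_ _ /(_ [set: T])] := FcE y.
have /[swap]/[apply] : G [set: T].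
  by case: sG => G0 GC _; rewrite -(setD0 [set: T]); exact: GC.
by rewrite unlock setTI => ->.
Qed.

(** Difference quotients are linear in the function, so they commute with the
    expectation. *)
Lemma expectation_diff_quotient x y : ('E_P[fun w => diff_quotient (Fc w) x y] =
  (diff_quotient (fun z => fine (cdf X z)) x y)%:E)%E.
Proof.
have L1 z : (fun w => Fc w z) \in Lfun P 1.
  by apply/Lfun1_integrable; have [] := FcE z.
have -> : (fun w => diff_quotient (Fc w) x y) =
    (y - x)^-1 \o* ((fun w => Fc w y) \- (fun w => Fc w x)).
  by apply/funext => w; rewrite /diff_quotient /= mulrC.
rewrite expectationZl ?rpredB// expectationB// !expectation_cond_cdf.
rewrite -[cdf X y]fineK ?fin_num_measure// -[cdf X x]fineK ?fin_num_measure//.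
by rewrite -EFinB -EFinM mulrC.
Qed.
End cond_cdf.

(** * Expectation and variance of the conditional density *)

Theorem proposition1 (d : measure_display) (T : measurableType d)
    (R : realType) (P : probability T R) (X : {RV P >-> R}) (f : R -> R)
    (a b : R) (ab : a < b)
    (fE : forall x, a <= x <= b ->
      is_derive_within `[a, b] (fun y => fine (cdf X y)) x (f x))
    (G : set (set T)) (sG : sigma_algebra [set: T] G)
    (subG : G `<=` measurable)
    (Fc : T -> cumulativeBounded (0 : R) (1 : R))
    (FcE : is_regular_cond_cdf X G Fc)
    (D : T -> set R)
    (Fc_cont : forall w, {within `[a, b], continuous (Fc w)})
    (D_sub : forall w, D w `<=` `[a, b])
    (D_count : forall w, countable (D w))
    (Fc_diff : forall w x, (`[a, b] `\` D w) x ->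
      derivable_within `[a, b] (Fc w) x)
    (Fc_ae_diff : forall x, a <= x <= b ->
      {ae P, forall w, derivable_within `[a, b] (Fc w) x})
    (Gamma : {RV P >-> R}) (Kgamma : R)
    (Gamma2 : ('E_P[fun w => (Gamma w ^+ 2)%R] <= Kgamma%:E)%E)
    (Fc_bound : {ae P, forall w,
      (ereal_sup [set (derive_within `[a, b] (Fc w) x)%:E
                 | x in `[a, b] `\` D w] <= (Gamma w)%:E)%E}) :
  forall x, a <= x <= b ->
    ('E_P[fun w => derive_within `[a, b] (Fc w) x] = (f x)%:E)%E /\
    ('V_P[fun w => derive_within `[a, b] (Fc w) x] <= Kgamma%:E)%E.
Proof.
move=> x abx.
pose u := approach a b x.
have u_neq n : u n != x by exact: approach_neq.
have u_itv n : a <= u n <= b by exact: approach_itv.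
have u_cvg : u n @[n --> \oo] --> within `[a, b] x^' by exact: cvg_approach.
have [N [mN N0 subN]] := filterI (Fc_ae_diff x abx) Fc_bound.
have offN w : ~ N w -> derivable_within `[a, b] (Fc w) x /\
    forall s t, a <= s -> s < t -> t <= b ->
      Fc w t - Fc w s <= Gamma w * (t - s).
  move=> Nw; have [dx bnd] : (derivable_within `[a, b] (Fc w) x /\ _) :=
    contrapT (fun H => Nw (subN w H)).
  split => //; apply: (increment_le _ _ _ _ (D w)) => // z zD.
  exists (derive_within `[a, b] (Fc w) z); first exact: Fc_diff.
  by rewrite -lee_fin; apply: le_trans bnd; apply: ereal_sup_ubound; exists z.
apply: (moments_of_dominated_limit _ _ _ _ N
    (fun n w => diff_quotient (Fc w) x (u n)) _ Gamma) => //.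
- move=> n; apply: measurable_funM => //; apply: measurable_funB;
    exact: measurable_cond_cdf subG FcE _.
- by move=> w /offN[dx _]; exact: cvg_comp u_cvg dx.
- move=> n w /offN[_ inc].
  apply: diff_quotient_bound inc abx (u_itv n) (u_neq n).
  exact: cumulative_is_nondecreasing.
under eq_fun do rewrite (expectation_diff_quotient _ _ _ _ X G)//.
apply: cvg_EFin; first exact: nearW.
exact: cvg_comp u_cvg (fE x abx).
Qed.
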